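(* Every chordal graph $G$ has convex crossing number $$\mathrm{cr}^{\star}(G)\leq\sum_{vw\in E(G)}\deg(v)\deg(w).$$
   Context: All graphs are undirected, simple and finite. A graph is chordal if every induced cycle is a triangle. A convex drawing of a graph represents the vertices by distinct points in the plane in convex position and each edge by the line-segment between its endpoints, such that the only vertices an edge intersects are its own endpoints, and no three edges intersect at a common point (except at a common endpoint). A crossing is a point of intersection between two edges other than a common endpoint. The convex crossing number $\mathrm{cr}^{\star}(G)$ is the minimum number of crossings in a convex drawing of $G$. *)

(* Defs.v *)
From HB Require Import structures.
From mathcomp Require Import all_boot all_order all_algebra.
From mathcomp Require Import all_classical all_reals interval_inference convex.
From mathcomp Require Import ring lra.

Set Implicit Arguments.
Unset Strict Implicit.
Unset Printing Implicit Defensive.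

Import Order.TTheory GRing.Theory Num.Theory.

Local Open Scope classical_set_scope.
Local Open Scope card_scope.
Local Open Scope ring_scope.
Local Open Scope convex_scope.

Record sgraph := SGraph {
  vertex :> finType;
  adj : rel vertex;
  adj_sym : symmetric adj;
  adj_irr : irreflexive adj }.

Definition edges (G : sgraph) : {set {set G}} :=
  ([set [set p.1; p.2] | p : G * G & adj p.1 p.2])%SET.

Definition deg (G : sgraph) (v : G) : nat := #|[set w | adj v w]%SET|.

(* Cycles are duplicate-free cyclic sequences; the last condition says that
   the cycle has no chord. *)
Definition induced_cycle (G : sgraph) (c : seq G) : Prop :=
  [/\ (3 <= size c)%N, ucycle (@adj G) c &
      {in c &, forall x y, adj x y -> y = next c x \/ x = next c y}].

Definition chordal (G : sgraph) : Prop :=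
  forall c : seq G, induced_cycle c -> size c = 3.

Definition plane (R : realType) := convex_lmodType 'rV[R]_2.

Definition convex_hull (R : realType) (A : set (plane R)) : set (plane R) :=
  smallest (@convex_set R 'rV[R]_2) A.

Definition segment (R : realType) (p q : plane R) : set (plane R) :=
  [set p <| t |> q | t in [set: {i01 R}]].

Section Drawing.
Variables (R : realType) (G : sgraph).
Implicit Types (pos : G -> plane R) (e f g : {set G}) (x : plane R).

Definition edge_segment pos e : set (plane R) :=
  [set x | exists u v, e = [set u; v]%SET /\ segment (pos u) (pos v) x].

Definition convex_position pos : Prop :=
  forall v, ~ convex_hull (pos @` [set u | u <> v]) (pos v).

Record convex_drawing := ConvexDrawing {
  pos :> G -> plane R;
  pos_inj : injective pos;
  pos_convex : convex_position pos;
  edge_avoids_vertices : forall e v,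
    e \in edges G -> edge_segment pos e (pos v) -> v \in e;
  no_three_edges : forall e f g x,
    [/\ e \in edges G, f \in edges G & g \in edges G] ->
    [/\ e != f, e != g & f != g] ->
    [/\ edge_segment pos e x, edge_segment pos f x & edge_segment pos g x] ->
    exists2 v, [/\ v \in e, v \in f & v \in g] & x = pos v }.

Definition crossings pos : set (plane R) :=
  [set x | exists e f,
    [/\ e \in edges G, f \in edges G & e != f] /\
    [/\ edge_segment pos e x, edge_segment pos f x &
        ~ exists2 v, v \in e /\ v \in f & x = pos v]].

End Drawing.

(* A convex drawing exists: place the vertices on the parabola y = x ^ 2 at
   abscissas such that no three pairwise disjoint chords are concurrent. *)
Section Existence.
Variable R : realType.

(* The chord through the points of abscissas a and b has equation
   y = (a + b) x - a b; three such lines are concurrent only if this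
   determinant vanishes. *)
Let D (a b c d e f : R) : R :=
  (c + d - (a + b)) * (e * f) + (a * b - c * d) * (e + f)
  + (a + b) * (c * d) - (a * b) * (c + d).

Let coef (a b c d e : R) : R := e * (c + d - (a + b)) + a * b - c * d.

Let const (a b c d e : R) : R :=
  e * (a * b - c * d) + (a + b) * (c * d) - (a * b) * (c + d).

Let bad_one (a b c d e : R) := - const a b c d e / coef a b c d e.

Let bad (s : seq R) : seq R :=
  flatten [seq [seq bad_one q.1.1.1 q.1.1.2 q.1.2 q.2 e | e <- s]
          | q <- allpairs pair (allpairs pair (allpairs pair s s) s) s].

Let badP s a b c d e : a \in s -> b \in s -> c \in s -> d \in s -> e \in s ->
  bad_one a b c d e \in bad s.
Proof.
move=> sa sb sc sd se; apply/flatten_mapP; exists (a, b, c, d).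
  by do ![apply: allpairs_f => //].
exact: map_f.
Qed.

Let D_neq0 a b c d e f : a != c -> a != d -> b != e ->
  f != bad_one a b c d e -> D a b c d e f != 0.
Proof.
move=> ac ad be fb; apply/eqP => D0.
have DE : coef a b c d e * f + const a b c d e = 0.
  by rewrite -D0 /D /coef /const; ring.
have [K0|K0] := eqVneq (coef a b c d e) 0.
  have L0 : const a b c d e = 0 by rewrite -DE K0 mul0r add0r.
  have : (a - c) * (a - d) * (b - e) = 0.
    transitivity (coef a b c d e * a + const a b c d e).
      by rewrite /coef /const; ring.
    by rewrite K0 L0 mul0r addr0.
  by move/eqP; rewrite !mulf_eq0 !subr_eq0 (negPf ac) (negPf ad) (negPf be).
case/eqP: fb; rewrite /bad_one; apply: (mulfI K0).
rewrite mulrCA divff // mulr1; apply/eqP; rewrite -addr_eq0; exact/eqP.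
Qed.

Let generic (s : seq R) := forall a b c d e f,
  {subset [:: a; b; c; d; e; f] <= s} -> uniq [:: a; b; c; d; e; f] ->
  D a b c d e f != 0.

Let fresh (s : seq R) : exists x, x \notin s.
Proof.
exists (1 + \sum_(y <- s) `|y|); apply/negP => xs.
have le_sum x : x \in s -> `|x| <= \sum_(y <- s) `|y|.
  by move=> sx; rewrite (big_rem _ sx) /= lerDl sumr_ge0.
have := le_trans (ler_norm _) (le_sum _ xs); lra.
Qed.

Let generic_seq n : exists s : seq R, [/\ size s = n, uniq s & generic s].
Proof.
elim: n => [|n [s [sz us gs]]].
  exists [::]; split=> // a b c d e f /(_ a); rewrite inE eqxx => /(_ isT).
  by rewrite in_nil.
have [x] := fresh (s ++ bad s); rewrite mem_cat negb_or => /andP[xs xb].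
exists (x :: s); split; [by rewrite /= sz | by rewrite /= xs |].
have nb a b c d e : a \in s -> b \in s -> c \in s -> d \in s -> e \in s ->
    x != bad_one a b c d e.
  by move=> sa sb sc sd se; apply: contraNneq xb => ->; exact: badP.
have key a b c d e : {subset [:: a; b; c; d; e] <= s} ->
    a != c -> a != d -> b != e -> D a b c d e x != 0.
  move=> sub ac ad be; apply: D_neq0 => //.
  by apply: nb; apply: sub; rewrite !inE eqxx ?orbT.
have mem y : y \in x :: s -> y != x -> y \in s.
  by rewrite inE => /orP[/eqP->|//]; rewrite eqxx.
have allE t : {subset t <= x :: s} -> all (fun y => y != x) t ->
    {subset t <= s}.
  by move=> sub /allP al y ty; apply: mem; [exact: sub | exact: al].
move=> a b c d e f sub.
rewrite /= !inE !negb_or -!andbA.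
move=> /and5P[ab ac ad ae /and5P[af bc bd be /and5P[bf cd ce cf /and4P[de df ef _]]]].
have tac (t : seq R) : {subset t <= [:: a; b; c; d; e; f]} ->
    all (fun y => y != x) t -> {subset t <= s}.
  by move=> st al; apply: allE al => y /st /sub.
have [fx|fx] := eqVneq f x; first subst x.
  apply: key => //; apply: tac => [y|/=]; last by rewrite af bf cf df ef.
  by rewrite !inE; do ![case/orP => [->|]; rewrite ?orbT //]; move=> ->; rewrite ?orbT.
have [ex|ex] := eqVneq e x; first subst x.
  have -> : D a b c d e f = D a b c d f e by rewrite /D; ring.
  apply: key => //; apply: tac => [y|/=]; last by rewrite ae be ce de fx.
  by rewrite !inE; do ![case/orP => [->|]; rewrite ?orbT //]; move=> ->; rewrite ?orbT.
have [dx|dx] := eqVneq d x; first subst x.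
  have -> : D a b c d e f = - D a b e f c d by rewrite /D; ring.
  rewrite oppr_eq0; apply: key => //; apply: tac => [y|/=]; last first.
    by rewrite ad bd ex fx cd.
  by rewrite !inE; do ![case/orP => [->|]; rewrite ?orbT //]; move=> ->; rewrite ?orbT.
have [cx|cx] := eqVneq c x; first subst x.
  have -> : D a b c d e f = - D a b e f d c by rewrite /D; ring.
  rewrite oppr_eq0; apply: key => //; apply: tac => [y|/=]; last first.
    by rewrite ac bc ex fx dx.
  by rewrite !inE; do ![case/orP => [->|]; rewrite ?orbT //]; move=> ->; rewrite ?orbT.
have [bx|bx] := eqVneq b x; first subst x.
  have -> : D a b c d e f = D c d e f a b by rewrite /D; ring.
  apply: key => //; last by rewrite eq_sym.
  apply: tac => [y|/=]; last by rewrite cx dx ex fx ab.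
  by rewrite !inE; do ![case/orP => [->|]; rewrite ?orbT //]; move=> ->; rewrite ?orbT.
have [ax|ax] := eqVneq a x; first subst x.
  have -> : D a b c d e f = D c d e f b a by rewrite /D; ring.
  apply: key => //; last by rewrite eq_sym.
  apply: tac => [y|/=]; last by rewrite cx dx ex fx bx.
  by rewrite !inE; do ![case/orP => [->|]; rewrite ?orbT //]; move=> ->; rewrite ?orbT.
by apply: gs; [apply: tac => //=; rewrite ax bx cx dx ex fx
  | rewrite /= !inE !negb_or ab ac ad ae af bc bd be bf cd ce cf de df ef].
Qed.

Variable G : sgraph.

Let generic_fun : exists2 t : G -> R, injective t &
  forall a b c d e f, uniq [:: a; b; c; d; e; f] ->
    D (t a) (t b) (t c) (t d) (t e) (t f) != 0.
Proof.
have [s [sz us gs]] := generic_seq #|G|.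
pose t (v : G) := nth 0 s (enum_rank v).
have ts v : t v \in s by apply: mem_nth; rewrite sz; exact: ltn_ord.
have tI : injective t.
  move=> u v /eqP; rewrite nth_uniq ?sz ?ltn_ord // => /eqP/ord_inj.
  exact: enum_rank_inj.
exists t => // a b c d e f; rewrite -(map_inj_uniq tI) => us'; apply: gs us' => y.
by rewrite !inE => /or4P[||/eqP->|/or3P[]] => // /eqP->.
Qed.

Section Parabola.
Variable t : G -> R.
Hypothesis tI : injective t.
Hypothesis tD : forall a b c d e f, uniq [:: a; b; c; d; e; f] ->
  D (t a) (t b) (t c) (t d) (t e) (t f) != 0.

Let P (v : G) : plane R := (\row_(j < 2) t v ^+ j.+1 : 'rV[R]_2).

Let X (p : plane R) : R := (p : 'rV[R]_2) 0 0.
Let Y (p : plane R) : R := (p : 'rV[R]_2) 0 1.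

Let XP v : X (P v) = t v. Proof. by rewrite /X mxE expr1. Qed.
Let YP v : Y (P v) = t v ^+ 2. Proof. by rewrite /Y mxE. Qed.

Let XC (k : {i01 R}) p q :
  X (p <| k |> q) = k%:num * X p + (1 - k%:num) * X q.
Proof. by rewrite /X [(_ <| _ |> _)]/(_ *: _ + _ *: _) !mxE. Qed.
Let YC (k : {i01 R}) p q :
  Y (p <| k |> q) = k%:num * Y p + (1 - k%:num) * Y q.
Proof. by rewrite /Y [(_ <| _ |> _)]/(_ *: _ + _ *: _) !mxE. Qed.

Let XY p q : X p = X q -> Y p = Y q -> p = q.
Proof.
move=> xx yy; apply/rowP => j.
have [->|->] : j = 0 \/ j = 1.
  by case: j => [[|[|//]] ?]; [left|right]; apply/val_inj.
- exact: xx.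
- exact: yy.
Qed.

Let P_inj : injective P.
Proof. by move=> u v /(congr1 X); rewrite !XP => /tI. Qed.

Let P_convex : convex_position P.
Proof.
move=> v; pose H : set (plane R) :=
  [set p | 0 < Y p - 2 * t v * X p + t v ^+ 2].
move=> /(_ H) /=; rewrite /H /= XP YP => h.
suff : 0 < t v ^+ 2 - 2 * t v * t v + t v ^+ 2.
  by rewrite (_ : _ + _ = 0) ?ltxx //; ring.
apply: h; split=> [p q k|_ [u /= /eqP uv <-]].
  rewrite !inE /= => Hp Hq; rewrite XC YC.
  have k0 : 0 <= k%:num by [].
  have k1 : k%:num <= 1 by [].
  have [kh|kh] := leP k%:num (2^-1); nra.
rewrite XP YP (_ : _ + _ = (t u - t v) ^+ 2); last by ring.
by rewrite exprn_even_gt0 //= subr_eq0 (inj_eq tI).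
Qed.

Let edge2 u v : [set u; v]%SET \in edges G -> u != v.
Proof.
case/imsetP => -[a b]; rewrite inE /= => ab E; apply/eqP => uv.
have : #|[set a; b]%SET| = 1%N by rewrite -E uv finset.setUid cards1.
rewrite cards2; case: eqP => // ab'; by rewrite ab' adj_irr in ab.
Qed.

Let chord u v x : segment (P u) (P v) x ->
  Y x = (t u + t v) * X x - t u * t v.
Proof. by case=> k _ <-; rewrite XC YC !XP !YP; ring. Qed.

Let P_avoid e v : e \in edges G -> edge_segment P e (P v) -> v \in e.
Proof.
move=> _ [a [b [-> /chord]]]; rewrite XP YP => h.
have : (t v - t a) * (t v - t b) = 0 by lra.
move/eqP; rewrite mulf_eq0 !subr_eq0 !(inj_eq tI) => /orP[]/eqP->.
  exact: set21.
exact: set22.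
Qed.

Let common a b c x : b != c -> segment (P a) (P b) x -> segment (P a) (P c) x ->
  x = P a.
Proof.
move=> bc /chord h /chord h'.
have : (t b - t c) * (X x - t a) = 0.
  by lra.
move/eqP; rewrite mulf_eq0 !subr_eq0 (inj_eq tI) (negPf bc) /= => /eqP Xx.
by apply: XY; rewrite ?XP ?YP // h Xx; ring.
Qed.

Let segmentC (p q : plane R) : segment p q `<=` segment q p.
Proof. by move=> x [k _ <-]; rewrite convC; eexists. Qed.

Let at_vertex (e : {set G}) v u w : e = [set u; w]%SET -> v \in e ->
  exists2 w', e = [set v; w']%SET & segment (P u) (P w) `<=` segment (P v) (P w').
Proof.
move=> ->; rewrite !inE => /orP[]/eqP->; first by exists w.
by exists u; [rewrite finset.setUC | exact: segmentC].
Qed.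

Let share (e f : {set G}) v x : e != f -> v \in e -> v \in f ->
  edge_segment P e x -> edge_segment P f x -> x = P v.
Proof.
move=> ef ve vf [a [b [E ab]]] [c [d [F cd]]].
have [b' E' sb] := at_vertex E ve; have [d' F' sd] := at_vertex F vf.
have bd : b' != d' by apply: contraNneq ef => bd; rewrite E' F' bd.
exact: common bd (sb _ ab) (sd _ cd).
Qed.

Let P_three e f g x :
  [/\ e \in edges G, f \in edges G & g \in edges G] ->
  [/\ e != f, e != g & f != g] ->
  [/\ edge_segment P e x, edge_segment P f x & edge_segment P g x] ->
  exists2 v, [/\ v \in e, v \in f & v \in g] & x = P v.
Proof.
move=> [Ee Ef Eg] [ef eg fg] [xe xf xg].
have fin v : x = P v -> exists2 v, [/\ v \in e, v \in f & v \in g] & x = P v.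
  by move=> xv; exists v => //; rewrite xv in xe xf xg; split; exact: P_avoid.
have pair (h k : {set G}) : h != k -> edge_segment P h x -> edge_segment P k x ->
    (exists v, x = P v) \/ [disjoint h & k]%B.
  move=> hk xh xk; case: (boolP [disjoint h & k]%B); first by right.
  case/pred0Pn => v /andP[/= vh vk]; left; exists v.
  exact: (share hk vh vk xh xk).
have [[v /fin //]|def] := pair _ _ ef xe xf.
have [[v /fin //]|deg] := pair _ _ eg xe xg.
have [[v /fin //]|dfg] := pair _ _ fg xf xg.
case: xe xf xg => a [b [ae /chord xe]] [c [d [cf /chord xf]]] [m [n [mg /chord xg]]].
subst e f g; exfalso.
have dis (u v w z : G) : [disjoint [set u; v]%SET & [set w; z]%SET]%B ->
    [/\ u != w, u != z, v != w & v != z].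
  move=> /pred0P h; have := h u; have := h v.
  rewrite /= !inE !eqxx orbT /= => /negbT + /negbT.
  by rewrite !negb_or => /andP[-> ->] /andP[-> ->].
have [ac ad bc bd] := dis _ _ _ _ def; have [am an bm bn] := dis _ _ _ _ deg.
have [cm cn dm dn] := dis _ _ _ _ dfg.
have /eqP[] : D (t a) (t b) (t c) (t d) (t m) (t n) != 0.
  apply: tD; rewrite /= !inE !negb_or (edge2 Ee) (edge2 Ef) (edge2 Eg).
  by rewrite ac ad bc bd am an bm bn cm cn dm dn.
move: xe xf xg; rewrite /D; set x1 := X x; set y1 := Y x.
move: (t a + t b) (t a * t b) (t c + t d) (t c * t d) (t m + t n) (t m * t n).
move=> s1 p1 s2 p2 s3 p3 h1 h2 h3.
have e1 : p1 = s1 * x1 - y1 by lra.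
have e2 : p2 = s2 * x1 - y1 by lra.
have e3 : p3 = s3 * x1 - y1 by lra.
by rewrite e1 e2 e3; ring.
Qed.

Let P_drawing : convex_drawing R G :=
  ConvexDrawing P_inj P_convex P_avoid P_three.

Let tsum (e : {set G}) := \sum_(v in e) t v.
Let tprod (e : {set G}) := \prod_(v in e) t v.

Let big2 u v : u != v -> tsum [set u; v]%SET = t u + t v /\
  tprod [set u; v]%SET = t u * t v.
Proof. by move=> uv; rewrite /tsum /tprod !big_setU1 ?big_set1 ?inE. Qed.

Let on_line e x : e \in edges G -> edge_segment P e x ->
  Y x = tsum e * X x - tprod e.
Proof.
by move=> Ee [u [v [E /chord->]]]; rewrite E in Ee *; have [-> ->] := big2 (edge2 Ee).
Qed.

Let edge_root e v : e \in edges G ->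
  (v \in e) = (t v ^+ 2 - tsum e * t v + tprod e == 0).
Proof.
move=> Ee; case/imsetP: (Ee) => -[a b] _ /= E; rewrite E in Ee *.
have [-> ->] := big2 (edge2 Ee).
rewrite (_ : _ + _ = (t v - t a) * (t v - t b)); last by ring.
by rewrite mulf_eq0 !subr_eq0 !(inj_eq tI) !inE.
Qed.

Let P_finite : finite_set (crossings P).
Proof.
pose I (e f : {set G}) := [set x | [/\ e \in edges G, f \in edges G & e != f] /\
  (edge_segment P e x /\ edge_segment P f x)].
apply: (@sub_finite_set _ _ (\bigcup_(q in [set: {set G} * {set G}]) I q.1 q.2)).
  by move=> x [e [f [h [xe xf _]]]]; exists (e, f).
apply: bigcup_finite => [|[e f] _ /=]; first exact: finite_finset.
have [[x Ix]|nI] := pselect (exists x, I e f x); last first.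
  rewrite (_ : I e f = set0) //; apply/seteqP; split=> // y Iy.
  by case: nI; exists y.
apply: (@sub_finite_set _ _ [set x]) => // y Iy /=.
case: Ix Iy => -[Ee Ef ef] [xe xf] [_ [ye yf]].
have h : (tsum e - tsum f) * (X y - X x) = 0.
  have := on_line Ee xe; have := on_line Ef xf.
  have := on_line Ee ye; have := on_line Ef yf; lra.
move/eqP: h; rewrite mulf_eq0 !subr_eq0 => /orP[]/eqP h; last first.
  by apply: XY; rewrite ?(on_line Ee xe) ?(on_line Ee ye) ?h.
case/eqP: ef; apply/setP => v; rewrite !edge_root // -h.
suff -> : tprod e = tprod f by [].
by have := on_line Ee xe; have := on_line Ef xf; rewrite h; lra.
Qed.

Lemma parabola_crossing_number :
  exists k, `[< exists d : convex_drawing R G, crossings d #= `I_k >].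
Proof. by have [k kP] := P_finite; exists k; apply/asboolP; exists P_drawing. Qed.

End Parabola.

Lemma convex_drawing_exists :
  exists k, `[< exists d : convex_drawing R G, crossings d #= `I_k >].
Proof. by have [t tI tD] := generic_fun; exact: parabola_crossing_number tI tD. Qed.

End Existence.

(* The least k such that some convex drawing has exactly k crossing points. *)
Definition convex_crossing_number (R : realType) (G : sgraph) : nat :=
  ex_minn (convex_drawing_exists R G).

(* Main.v *)
(* A chordal graph has a perfect elimination order, hence an elimination forest in
   which every edge joins a vertex to an ancestor, adjacent to all vertices in
   between. Place the vertices in convex position in preorder of this forest. If
   edges ab and cd cross, with a < c < b < d, then c lies between a and b in the
   forest, so ac is an edge. Charging the crossing to ac, each edge ac receives at
   most deg(a) deg(c) crossings. Convex position is realised on a parabola, with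
   abscissae growing so fast that no three disjoint chords are concurrent. *)

Require Import Defs.
From HB Require Import structures.
From mathcomp Require Import all_boot all_order all_algebra.
From mathcomp Require Import all_classical all_reals.
From mathcomp Require Import interval_inference convex zify ring lra.

Set Implicit Arguments.
Unset Strict Implicit.
Unset Printing Implicit Defensive.

Import Order.TTheory GRing.Theory Num.Theory.

(** * Chordless paths and induced cycles *)

(** A walk of least length works: a repeated vertex or an edge between non-consecutive vertices
    would shorten it. *)
Lemma shortest_path (T : finType) (e : rel T) (x y : T) : connect e x y ->
  exists p, [/\ path e x p, last x p = y, uniq (x :: p) &
    forall i j, (i.+1 < j)%N -> (j <= size p)%N ->
      ~~ e (nth x (x :: p) i) (nth x (x :: p) j)].
Proof.
move=> /connectP[p0 ep0 ->].
pose P n := `[< exists2 p, path e x p & last x p = last x p0 /\ size p = n >].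
have exP : exists n, P n by exists (size p0); apply/asboolP; exists p0.
case: (ex_minnP exP) => m /asboolP[p ep [lp sp]] minp.
have {}minp q : path e x q -> last x q = last x p0 -> (size p <= size q)%N.
  by move=> eq lq; rewrite sp; apply/minp/asboolP; exists q.
exists p; split=> //.
  have [q eq uq] : exists2 q, path e x q /\ last x q = last x p &
      uniq (x :: q) /\ {subset q <= p}.
    by case/shortenP: ep => q eq uq sub; exists q.
  apply: (leq_size_uniq uq.1); last by rewrite ltnS minp // ?eq.1 ?eq.2.
  by move=> z; rewrite !inE => /orP[->//|/uq.2 ->]; rewrite orbT.
have lastE i : (i <= size p)%N -> last x (take i p) = nth x (x :: p) i.
  by move=> ip; rewrite (last_nth x) size_takel // -[x :: take i p]/(take i.+1 (x :: p)) nth_take.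
(* From here [j] stands for the former [j] minus one, so [drop j p] starts at the far end of the
   supposed chord. *)
move=> i [//|j] ij jp; rewrite ltnS in ij; apply/negP => eij.
have: (size p <= size (take i p ++ drop j p))%N.
  have dE : drop j p = nth x p j :: drop j.+1 p by rewrite (drop_nth x).
  apply: minp; rewrite ?cat_path ?last_cat dE /=.
    rewrite take_path //= lastE ?eij /=; last by lia.
    by move: ep; rewrite -{1}(cat_take_drop j.+1 p) cat_path lastE // => /andP[].
  by rewrite -lp -[in RHS](cat_take_drop j.+1 p) last_cat lastE.
by rewrite size_cat size_takel ?size_drop; lia.
Qed.

(* A shortest path through [U] closes up to an induced cycle through [v]. *)
Lemma chordal_bypass (G : sgraph) (v x y : G) (U : {set G}) : chordal G ->
  {in U, forall w, w != v /\ ~~ adj v w} -> adj v x -> adj v y -> x != y ->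
  connect [rel a b | [&& adj a b, a \in x |: (y |: U) & b \in x |: (y |: U)]]%SET x y ->
  adj x y.
Proof.
move=> chG vU vx vy xy /shortest_path[p [ep lp up ind]].
have sp : (0 < size p)%N by case: p lp {ep up ind} => // /esym/eqP; rewrite eq_sym (negPf xy).
have ep' i : (i < size p)%N -> adj (nth x (x :: p) i) (nth x p i) /\
    nth x p i \in (x |: (y |: U))%SET.
  by move=> /((pathP x ep) i) /and3P[].
have inD : {subset x :: p <= x |: (y |: U)}%SET.
  move=> z; rewrite inE => /orP[/eqP->|zp]; first by rewrite !inE eqxx.
  by rewrite -(nth_index x zp); case: (ep' (index z p)) => //; rewrite index_mem.
have Dv z : z \in (x |: (y |: U))%SET -> z != v /\ (adj v z -> z = x \/ z = y).
  rewrite !inE => /or3P[/eqP->|/eqP->|/vU[zv /negPf->]]; last by split.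
    by split; [apply: contraTneq vx => ->; rewrite adj_irr | left].
  by split; [apply: contraTneq vy => ->; rewrite adj_irr | right].
pose c := v :: x :: p.
have uc : uniq c.
  by rewrite /c cons_uniq up andbT; apply/negP => /inD/Dv[]; rewrite eqxx.
have adjp : path (@adj G) x p by apply: sub_path ep => a b /and3P[].
have cyc : ucycle (@adj G) c.
  by rewrite /ucycle uc andbT /= rcons_path vx adjp lp adj_sym vy.
have ind' i j : (i.+1 < j)%N -> (j <= size p)%N ->
    ~~ adj (nth v (x :: p) i) (nth v (x :: p) j).
  move=> ij jp; have ip : (i <= size p)%N by lia.
  have := ind i j ij jp; rewrite /= !(set_nth_default v x) //.
  by rewrite !inD ?mem_nth // !andbT.
have ny : y = nth v (x :: p) (size p).
  by rewrite -lp (last_nth x) (set_nth_default v x).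
(* At the last index the right side is out of range, and its default value [v] is the wrap-around of
   the cycle. *)
have nxt i : (i < size c)%N -> next c (nth v c i) = nth v (x :: p) i.
  by move=> ic; rewrite next_nth mem_nth // index_uniq.
have chord i j : (i < j)%N -> (j < size c)%N -> adj (nth v c i) (nth v c j) ->
    nth v c j = next c (nth v c i) \/ nth v c i = next c (nth v c j).
  move=> ij jc; rewrite !nxt ?(ltn_trans ij) //.
  case: i j ij jc => [|i] [|j] // ij jc; last first.
    rewrite ltnS in ij; rewrite /= ltnS in jc.
    move=> aij; left; have [->//|ne] := eqVneq j i.+1.
    by have /negP[] := ind' i j (ltac:(lia)) jc.
  rewrite [nth v c 0]/= [nth v c j.+1]/= => a0.
  have jin : nth v (x :: p) j \in x :: p by rewrite mem_nth.
  have [_ /(_ a0)[->|yj]] := Dv _ (inD _ jin); first by left.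
  right; have -> : j = size p.
    apply/eqP; rewrite -(nth_uniq v (s := x :: p)) -?ny ?yj //=.
  by rewrite [RHS]nth_default.
have ic : induced_cycle c.
  split=> // a b /(nthP v)[i ic <-] /(nthP v)[j jc <-] aij.
  case: (ltngtP i j) => [ij|ji|eij]; first exact: chord.
    by move: aij; rewrite adj_sym => /(chord _ _ ji ic)[]; [right|left].
  by rewrite eij adj_irr in aij.
(* The cycle is a triangle, so [p] consists of [y] alone and its only edge joins [x] to [y]. *)
have [/esym sp1] := chG c ic.
move: (ep' 0%N sp) ny; rewrite -sp1 /= => -[xp0 _] ->.
by rewrite (set_nth_default x).
Qed.

(** * Simplicial vertices and the elimination order *)

Definition clique (G : sgraph) (K : {set G}) : Prop :=
  {in K &, forall x y, x != y -> adj x y}.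

Definition simplicial (G : sgraph) (W : {set G}) (z : G) : Prop :=
  z \in W /\ clique [set x in W | adj z x]%SET.

(* Dirac: for a component [C] of [W] minus the closed neighbourhood of [v], the
   boundary [S] of [C] is a clique, and a simplicial vertex of [C :|: S] lying
   in [C] is simplicial in [W]. *)
Lemma simplicial_far (G : sgraph) (W : {set G}) (v w : G) : chordal G ->
  v \in W -> w \in W -> w != v -> ~~ adj v w ->
  exists z, [/\ simplicial W z, z != v & ~~ adj v z].
Proof.
move=> chG; have [n] := ubnP #|W|.
elim: n W v w => // n IH W v w Wn vW wW wv nvw.
pose U : {set G} := [set x in W | (x != v) && ~~ adj v x]%SET.
pose e := [rel a b : G | [&& adj a b, a \in U & b \in U]].
have eC : connect_sym e.
  by apply: sym_connect_sym => a b /=; rewrite adj_sym [(a \in U) && _]andbC.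
pose C : {set G} := [set x | connect e w x]%SET.
pose S : {set G} := [set x in W | (x \notin C) && [exists c in C, adj x c]]%SET.
have wU : w \in U by rewrite inE wW wv.
have CU : {subset C <= U}.
  move=> x; rewrite inE => /connectP[p ep ->].
  elim/last_ind: p ep => //= p y _; rewrite rcons_path last_rcons.
  by case/andP => _ /and3P[].
have CS x c : c \in C -> x \in W -> adj x c -> x \in (C :|: S)%SET.
  move=> cC xW xc; rewrite inE; case: (boolP (x \in C)) => //= xC.
  by rewrite inE xW xC; apply/existsP; exists c; rewrite cC.
have SvP x : x \in S -> adj v x.
  rewrite inE => /and3P[xW xC /existsP[c /andP[cC xc]]].
  apply: contraNT xC => nvx; have := CU _ cC; rewrite !inE => /and3P[cW cv vc].
  have xv : x != v by apply: contraNneq vc => <-.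
  move: cC; rewrite inE => wc; apply: connect_trans wc (connect1 _).
  by rewrite /= adj_sym xc !inE cW cv vc xW xv nvx.
(* Two vertices of [S] are joined by a path with interior in [C], avoiding [v] and its neighbours,
   while both are adjacent to [v]. *)
have Scl : clique S.
  move=> x y xS yS xy; apply: (@chordal_bypass G v x y U) => //.
  - by move=> z; rewrite inE => /and3P[].
  - exact: SvP.
  - exact: SvP.
  move: xS yS; rewrite !inE => /and3P[xW xC /existsP[c /andP[cC xc]]].
  move=> /and3P[yW yC /existsP[d /andP[dC yd]]].
  have cU := CU _ cC; have dU := CU _ dC.
  apply: (connect_trans (connect1 (y := c) _)) => /=.
    by rewrite xc !finset.in_setU1 cU eqxx !orbT.
  apply: (connect_trans (y := d)); last first.
    by apply: connect1; rewrite /= adj_sym yd !finset.in_setU1 dU eqxx !orbT.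
  apply: (connect_sub (e := e)).
    move=> a b /= /and3P[ab aU bU]; apply: connect1 => /=.
    by rewrite ab !finset.in_setU1 aU bU !orbT.
  by apply: (connect_trans (y := w)); [rewrite eC |]; move: cC dC; rewrite !inE.
have fin z : z \in C -> clique [set x in C :|: S | adj z x]%SET ->
    exists z, [/\ simplicial W z, z != v & ~~ adj v z].
  move=> zC cl; exists z; have := CU _ zC; rewrite inE => /and3P[zW zv vz].
  split=> //; split=> // x y; rewrite !finset.in_set => /andP[xW zx] /andP[yW zy].
  by apply: cl; rewrite finset.in_set ?zx ?zy andbT (CS _ z) // adj_sym.
have sub : {subset (C :|: S)%SET <= W}.
  by move=> x; rewrite inE => /orP[/CU|]; rewrite inE => /andP[].
have small : (#|(C :|: S)%SET| < n)%N.
  apply: leq_trans (Wn : (#|W| <= n)%N); apply: proper_card; apply/properP; split.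
    exact/fintype.subsetP.
  exists v => //; rewrite inE; apply/norP; split; apply/negP.
    by move/CU; rewrite !inE eqxx andbF.
  by move/SvP; rewrite adj_irr.
have wC : w \in C by rewrite inE connect0.
(* Induct with [s] in the role of [v]: the vertex found is not adjacent to [s], so it is outside the
   clique [S], hence in [C]. *)
have [/existsP[s /existsP[t]]|no] := boolP [exists s, exists t,
    [&& s \in S, t \in C :|: S, t != s & ~~ adj s t]%SET].
  case/and4P => sS tCS ts st.
  have sCS : s \in (C :|: S)%SET by rewrite inE sS orbT.
  have [z [[zCS cl] zs sz]] := IH _ s t small sCS tCS ts st.
  apply: (fin z) => //; move: zCS; rewrite finset.in_setU => /orP[//|zS].
  by move: sz; rewrite Scl // eq_sym.
have univ s t : s \in S -> t \in (C :|: S)%SET -> t != s -> adj s t.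
  move=> sS tCS ts; apply: contraNT no => st.
  by apply/existsP; exists s; apply/existsP; exists t; apply/and4P.
(* Now each vertex of [S] is adjacent to all the others of [C :|: S], so a vertex not adjacent to
   [s] again lies in [C]. If no such pair exists, [C :|: S] is a clique and [w] itself serves. *)
have [/existsP[s /existsP[t]]|cl] := boolP [exists s, exists t,
    [&& s \in C :|: S, t \in C :|: S, t != s & ~~ adj s t]%SET].
  case/and4P => sCS tCS ts st.
  have [z [[zCS cl] zs sz]] := IH _ s t small sCS tCS ts st.
  apply: (fin z) => //; move: zCS; rewrite finset.in_setU => /orP[//|zS].
  by move: sz; rewrite adj_sym univ // eq_sym.
apply: (fin w) => // x y; rewrite !finset.in_set => /andP[xW _] /andP[yW _] xy.
apply: contraNT cl => nxy; apply/existsP; exists x; apply/existsP; exists y.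
by rewrite !finset.in_set xW yW eq_sym xy.
Qed.

Lemma simplicial_exists (G : sgraph) (W : {set G}) (w : G) : chordal G ->
  w \in W -> exists z, simplicial W z.
Proof.
move=> chG wW.
have [/existsP[s /existsP[t /and4P[sW tW ts st]]]|cl] := boolP [exists s, exists t,
    [&& s \in W, t \in W, t != s & ~~ adj s t]%SET].
  by have [z []] := simplicial_far chG sW tW ts st; exists z.
exists w; split=> // x y; rewrite !inE => /andP[xW _] /andP[yW _] xy.
apply: contraNT cl => nxy; apply/existsP; exists x; apply/existsP; exists y.
by rewrite xW yW eq_sym xy.
Qed.

(* A perfect elimination order listed in preorder of its elimination forest:
   [b = d] says that the smaller neighbours of [b] form a clique, [b < d] that
   crossing edges have adjacent left ends. *)
Lemma chordal_rank (G : sgraph) : chordal G -> exists2 r : G -> nat,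
  injective r &
  forall a b c d, (r a < r c < r b)%N -> (r b <= r d)%N ->
    adj a b -> adj c d -> adj a c.
Proof.
move=> chG.
suff: forall W : {set G}, exists2 r : G -> nat, {in W &, injective r} &
    forall a b c d, a \in W -> b \in W -> c \in W -> d \in W ->
      (r a < r c < r b)%N -> (r b <= r d)%N -> adj a b -> adj c d -> adj a c.
  move=> /(_ [set: G]%SET)[r rI rP]; exists r => [x y|a b c d]; first exact: rI.
  exact: rP.
move=> W; have [n] := ubnP #|W|; elim: n W => // n IH W Wn.
have [->|[w wW]] := finset.set_0Vmem W.
  by exists (fun=> 0%N) => [x|a b c d]; rewrite inE.
have [v [vW vcl]] := simplicial_exists chG wW.
have [|r rI rP] := IH (W :\ v)%SET; first by rewrite (cardsD1 v) vW in Wn; lia.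
have inW x : x \in W -> x != v -> x \in (W :\ v)%SET by move=> *; apply/setD1P.
have vadj x : adj v x -> x != v by apply: contraTneq => ->; rewrite adj_irr.
have [/existsP[u0 /andP[u0W vu0]]|no] := boolP [exists u in W, adj v u]; last first.
  have nv x : x \in W -> ~~ adj v x.
    by move=> xW; apply: contraNN no => vx; apply/existsP; exists x; rewrite xW.
  (* Without neighbours, [v] is a new root, listed first. *)
  exists (fun x => if x == v then 0 else (r x).+1)%N.
    move=> x y xW yW; case: (eqVneq x v) (eqVneq y v) => [->|xv] [->|yv] //.
    by case=> /rI; apply; apply: inW.
  move=> a b c d aW bW cW dW rac rbd ab cd.
  have [av|av] := eqVneq a v; first by rewrite av (negPf (nv b bW)) in ab.
  have [bv|bv] := eqVneq b v.
    by rewrite bv adj_sym (negPf (nv a aW)) in ab.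
  have [cv|cv] := eqVneq c v; first by rewrite cv (negPf (nv d dW)) in cd.
  have [dv|dv] := eqVneq d v.
    by rewrite dv adj_sym (negPf (nv c cW)) in cd.
  move: rac rbd; rewrite (negPf av) (negPf bv) (negPf cv) (negPf dv) !ltnS => *.
  by apply: (rP a b c d); rewrite ?inW.
have u0N : (u0 \in W) && adj v u0 by rewrite u0W.
case: (arg_maxnP (P := fun u => (u \in W) && adj v u) r u0N) => u /andP[uW vu] umax.
have uv := vadj _ vu.
have ncl x y : x \in W -> y \in W -> adj v x -> adj v y -> x != y -> adj x y.
  by move=> xW yW vx vy; apply: vcl; rewrite inE ?xW ?yW.
(* Here [u] is the last neighbour of [v] and becomes its parent; doubling the ranks makes room for
   [v] immediately after [u]. *)
exists (fun x => if x == v then (r u).*2.+1 else (r x).*2)%N.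
  move=> x y xW yW; have odd2 i j : i.*2.+1 <> j.*2 by move/(congr1 odd); rewrite /= !odd_double.
  case: (eqVneq x v) (eqVneq y v) => [->|xv] [->|yv] // => [/odd2|/esym/odd2|] //.
  by move/double_inj/rI; apply; apply: inW.
move=> a b c d aW bW cW dW rac rbd ab cd.
(* All neighbours of [v] precede it, so [v] is neither of the left ends [a] and [c]. *)
have right x y : x \in W -> y \in W -> adj x y -> x = v -> y != v /\ (r y <= r u)%N.
  move=> xW yW xy xv; rewrite xv in xy; split; first exact: vadj.
  by apply: umax; rewrite yW.
have [av|av] := eqVneq a v.
  have [bv ru] := right _ _ aW bW ab av; case/andP: rac => rac rcb.
  by have := ltn_trans rac rcb; rewrite av eqxx (negPf bv) ltn_Sdouble ltnNge ru.
have [cv|cv] := eqVneq c v.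
  have [dv ru] := right _ _ cW dW cd cv; case/andP: rac => _ rcb.
  by have := leq_trans rcb rbd; rewrite cv eqxx (negPf dv) ltn_Sdouble ltnNge ru.
have rI' x y : x \in W -> y \in W -> x != v -> y != v -> r x = r y -> x = y.
  by move=> xW yW xv yv; apply: rI; apply: inW.
case/andP: rac rbd; rewrite (negPf av) (negPf cv) ltn_double.
have ne x y : (r x < r y)%N -> x != y by apply: contraTneq => ->; rewrite ltnn.
(* If just one right end is [v], it is replaced by [u]: the left end is adjacent to [u] because the
   neighbours of [v] form a clique. The case [c = u] is settled by that clique directly. *)
have [bv|bv] := eqVneq b v; have [dv|dv] := eqVneq d v;
  rewrite ?ltn_double ?ltnS ?leq_Sdouble ?leq_double.
- move=> rac _ _; rewrite bv adj_sym in ab; rewrite dv adj_sym in cd.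
  by apply: ncl => //; apply: ne.
- move=> rac rcu rud; rewrite bv adj_sym in ab.
  have [->|cu] := eqVneq c u; first by apply: ncl => //; apply: ne; exact: leq_trans rcu.
  have {}rcu : (r c < r u)%N.
    by rewrite ltn_neqAle rcu andbT; apply: contra_neq cu; apply: rI'.
  apply: (rP a u c d); rewrite ?inW ?rac ?rcu //; first exact: ltnW.
  by apply: ncl => //; apply: ne; exact: ltn_trans rcu.
- move=> rac rcb rbu; rewrite dv adj_sym in cd.
  apply: (rP a b c u); rewrite ?inW ?rac ?rcb //.
  by apply: ncl => //; apply: ne; exact: leq_trans rbu.
- by move=> rac rcb rbd; apply: (rP a b c d); rewrite ?inW ?rac ?rcb.
Qed.

Local Open Scope ring_scope.
Local Open Scope convex_scope.

(** * Abscissae without concurrent chords *)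

(** The recurrence meets the threshold [4 * M ^+ 3] of [concurrency_growth], with [M] the preceding
    term. *)
Fixpoint abscissa (n : nat) : nat := if n is m.+1 then (4 * abscissa m ^ 3)%N else 1%N.

Lemma abscissa_gt0 n : (0 < abscissa n)%N.
Proof. by elim: n => //= n IH; rewrite muln_gt0 expn_gt0 IH. Qed.

Lemma abscissa_mono : {mono abscissa : m n / (m < n)%N}.
Proof.
apply: leqW_mono; apply: leq_mono.
apply: (@homo_ltn _ _ (fun m n => (m < n)%N)) => [n m p|n]; first exact: ltn_trans.
by rewrite /= !expnS; have := abscissa_gt0 n; nia.
Qed.

Lemma abscissa_inj : injective abscissa.
Proof.
move=> m n mn; case: (ltngtP m n) => //.
  by rewrite -abscissa_mono mn ltnn.
by rewrite -abscissa_mono mn ltnn.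
Qed.

(* Vanishes iff the lines y = (a + b) x - a b, y = (c + d) x - c d and
   y = (e + f) x - e f are concurrent or parallel. *)
Definition concurrency (K : comNzRingType) (a b c d e f : K) : K :=
  (c + d - (a + b)) * (e * f) + (a * b - c * d) * (e + f)
  + (a + b) * (c * d) - (a * b) * (c + d).

(* [concurrency] is affine in [f]; its integer coefficients [k] and [l] do not
   both vanish because [k * a + l = (a - c) * (a - d) * (b - e)]. *)
Lemma concurrency_growth (M a b c d e f : int) :
  0 < a <= M -> 0 < b <= M -> 0 < c <= M -> 0 < d <= M -> 0 < e <= M ->
  4 * M ^+ 3 <= f -> a != c -> a != d -> b != e -> concurrency a b c d e f != 0.
Proof.
move=> aM bM cM dM eM Mf ac ad be; apply/eqP.
pose k := e * (c + d - (a + b)) + a * b - c * d.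
pose l := e * (a * b - c * d) + (a + b) * (c * d) - (a * b) * (c + d).
have -> : concurrency a b c d e f = k * f + l by rewrite /concurrency /k /l; ring.
move=> kl0; have [k0|k0] := eqVneq k 0.
  have : (a - c) * (a - d) * (b - e) = 0.
    have l0 : l = 0 by rewrite -kl0 k0; ring.
    by transitivity (k * a + l); [rewrite /k /l; ring | rewrite k0 l0; ring].
  by move/eqP; rewrite !mulf_eq0 !subr_eq0 (negPf ac) (negPf ad) (negPf be).
have le3 (x y z : int) : 0 < x <= M -> 0 < y <= M -> 0 < z <= M ->
    0 < x * y * z <= M ^+ 3.
  move=> /andP[x0 xM] /andP[y0 yM] /andP[z0 zM]; rewrite !mulr_gt0 //=.
  by rewrite exprSr expr2 !ler_pM // ?mulr_ge0 // ltW.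
(* [l] has three monomials of each sign, each between 0 and [M ^+ 3]; as [k] is a nonzero integer,
   [k * f] outweighs it. *)
have lM : - (3 * M ^+ 3) <= l <= 3 * M ^+ 3.
  have := le3 _ _ _ aM bM eM; have := le3 _ _ _ cM dM eM.
  have := le3 _ _ _ aM cM dM; have := le3 _ _ _ bM cM dM.
  have := le3 _ _ _ aM bM cM; have := le3 _ _ _ aM bM dM.
  have -> : l = a * b * e + a * c * d + b * c * d
                - (c * d * e + a * b * c + a * b * d) by rewrite /l; ring.
  lra.
have M0 : 0 < M ^+ 3 by rewrite exprn_gt0 //; lia.
have : 1 <= k \/ k <= -1 by lia.
by case/andP: lM => l1 l2; case=> hk; nra.
Qed.

(** Exchanging the ends of a chord or permuting the chords changes the determinant at most by a
    sign. So [n] may be taken largest, and the other abscissae are bounded by that of [n.-1]. *)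
Lemma concurrency_abscissa (i j k l m n : nat) : uniq [:: i; j; k; l; m; n] ->
  concurrency (abscissa i)%:Z (abscissa j) (abscissa k) (abscissa l)
    (abscissa m) (abscissa n) != 0.
Proof.
wlog ij : i j / (i < j)%N.
  move=> H u; case: (ltngtP i j) => ij; first exact: H.
    rewrite (_ : concurrency _ _ _ _ _ _ = concurrency (abscissa j)%:Z (abscissa i)
      (abscissa k) (abscissa l) (abscissa m) (abscissa n)).
      by apply: H => //; move: u; congr is_true; apply/perm_uniq/permP => P /=; clear; lia.
    by rewrite /concurrency; ring.
  by move: u; rewrite ij /= !inE eqxx.
wlog kl : k l / (k < l)%N.
  move=> H u; case: (ltngtP k l) => kl; first exact: H.
    rewrite (_ : concurrency _ _ _ _ _ _ = concurrency (abscissa i)%:Z (abscissa j)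
      (abscissa l) (abscissa k) (abscissa m) (abscissa n)).
      by apply: H => //; move: u; congr is_true; apply/perm_uniq/permP => P /=; clear; lia.
    by rewrite /concurrency; ring.
  by move: u; rewrite kl /= !inE eqxx !andbF.
wlog mn : m n / (m < n)%N.
  move=> H u; case: (ltngtP m n) => mn; first exact: H.
    rewrite (_ : concurrency _ _ _ _ _ _ = concurrency (abscissa i)%:Z (abscissa j)
      (abscissa k) (abscissa l) (abscissa n) (abscissa m)).
      by apply: H => //; move: u; congr is_true; apply/perm_uniq/permP => P /=; clear; lia.
    by rewrite /concurrency; ring.
  by move: u; rewrite mn /= !inE eqxx !andbF.
wlog ln : k l m n kl mn / (l < n)%N.
  move=> H u; case: (ltngtP l n) => ln; first exact: H.
    rewrite (_ : concurrency _ _ _ _ _ _ = - concurrency (abscissa i)%:Z (abscissa j)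
      (abscissa m) (abscissa n) (abscissa k) (abscissa l)).
      by rewrite oppr_eq0; apply: H => //; move: u; congr is_true;
        apply/perm_uniq/permP => P /=; clear; lia.
    by rewrite /concurrency; ring.
  by move: u; rewrite ln /= !inE eqxx !(orbT, andbF).
wlog jn : i j k l m n ij kl mn ln / (j < n)%N.
  move=> H u; case: (ltngtP j n) => jn; first exact: H.
    rewrite (_ : concurrency _ _ _ _ _ _ = concurrency (abscissa k)%:Z (abscissa l)
      (abscissa m) (abscissa n) (abscissa i) (abscissa j)).
      by apply: H => //; [exact: ltn_trans jn |];
        move: u; congr is_true; apply/perm_uniq/permP => P /=; clear; lia.
    by rewrite /concurrency; ring.
  by move: u; rewrite jn /= !inE eqxx !(orbT, andbF).
move=> u.
have le p : (p < n)%N -> 0 < (abscissa p)%:Z <= (abscissa n.-1)%:Z.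
  by move=> pn; rewrite ltz_nat abscissa_gt0 lez_nat leqNgt abscissa_mono; lia.
have ne p q : p != q -> (abscissa p)%:Z != abscissa q.
  by apply: contra_neq => -[] /abscissa_inj.
move: u; rewrite /= !inE !negb_or -!andbA.
move=> /and5P[_ ik il _ /andP[_ /and3P[_ _ /andP[jm _]]]].
apply: (@concurrency_growth (abscissa n.-1)%:Z); try (by apply: le; lia);
  try exact: ne.
by case: n {ij kl ln le} mn jn => //= n _ _; rewrite PoszM -rmorphXn.
Qed.

(** * Drawings on the parabola *)

Definition parabola (R : realType) (a : R) : plane R := (\row_(j < 2) a ^+ j.+1 : 'rV[R]_2).

Definition xcoord (R : realType) (p : plane R) : R := (p : 'rV[R]_2) 0 0.

Definition ycoord (R : realType) (p : plane R) : R := (p : 'rV[R]_2) 0 1.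

Lemma xcoord_parabola (R : realType) (a : R) : xcoord (parabola a) = a.
Proof. by rewrite /xcoord mxE expr1. Qed.

Lemma ycoord_parabola (R : realType) (a : R) : ycoord (parabola a) = a ^+ 2.
Proof. by rewrite /ycoord mxE. Qed.

Lemma parabola_inj (R : realType) : injective (@parabola R).
Proof. by move=> a b /(congr1 (@xcoord R)); rewrite !xcoord_parabola. Qed.

Lemma plane_eq (R : realType) (p q : plane R) :
  xcoord p = xcoord q -> ycoord p = ycoord q -> p = q.
Proof.
move=> xx yy; apply/rowP => j.
case: j => [[|[|//]] ij].
- by rewrite (_ : Ordinal ij = 0) //; apply/val_inj.
- by rewrite (_ : Ordinal ij = 1) //; apply/val_inj.
Qed.

Lemma xcoord_conv (R : realType) (k : {i01 R}) (p q : plane R) :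
  xcoord (p <| k |> q) = k%:num * xcoord p + (1 - k%:num) * xcoord q.
Proof. by rewrite /xcoord [(_ <| _ |> _)]/(_ *: _ + _ *: _) !mxE. Qed.

Lemma ycoord_conv (R : realType) (k : {i01 R}) (p q : plane R) :
  ycoord (p <| k |> q) = k%:num * ycoord p + (1 - k%:num) * ycoord q.
Proof. by rewrite /ycoord [(_ <| _ |> _)]/(_ *: _ + _ *: _) !mxE. Qed.

(** The sign of the product places the abscissa between [a] and [b] without knowing which is
    smaller. *)
Lemma parabola_chord (R : realType) (a b : R) (x : plane R) :
  segment (parabola a) (parabola b) x ->
  ycoord x = (a + b) * xcoord x - a * b /\ (xcoord x - a) * (xcoord x - b) <= 0.
Proof.
case=> k _ <-; rewrite xcoord_conv ycoord_conv !xcoord_parabola !ycoord_parabola.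
split; first by ring.
have k0 : 0 <= k%:num by [].
have k1 : k%:num <= 1 by [].
set h := k%:num in k0 k1 *.
have -> : (h * a + (1 - h) * b - a) * (h * a + (1 - h) * b - b) =
    - (h * (1 - h) * (a - b) ^+ 2) by ring.
by rewrite oppr_le0 mulr_ge0 ?sqr_ge0 // mulr_ge0 ?subr_ge0.
Qed.

(** The open half-plane above the tangent at a vertex is convex and contains all other vertices, but
    not that one. *)
Lemma parabola_convex (R : realType) (G : sgraph) (t : G -> R) : injective t ->
  convex_position (fun v => parabola (t v)).
Proof.
move=> tI v; pose H : set (plane R) :=
  [set p | 0 < ycoord p - 2 * t v * xcoord p + t v ^+ 2]%classic.
move=> /(_ H) /=; rewrite /H /= xcoord_parabola ycoord_parabola => h.
suff : 0 < t v ^+ 2 - 2 * t v * t v + t v ^+ 2.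
  by rewrite (_ : _ + _ = 0) ?ltxx //; ring.
apply: h; split=> [p q k|_ [u /= /eqP uv <-]].
  rewrite !inE /= => Hp Hq; rewrite xcoord_conv ycoord_conv.
  have k0 : 0 <= k%:num by [].
  have k1 : k%:num <= 1 by [].
  (* One of the two weights is at least one half, which keeps the inequality strict. *)
  have [kh|kh] := leP k%:num (2^-1); nra.
rewrite xcoord_parabola ycoord_parabola (_ : _ + _ = (t u - t v) ^+ 2); last by ring.
by rewrite exprn_even_gt0 //= subr_eq0 (inj_eq tI).
Qed.

Lemma edge_chord (R : realType) (G : sgraph) (t : G -> R) (e : {set G}) (x : plane R) :
  injective t -> e \in edges G -> edge_segment (fun v => parabola (t v)) e x ->
  exists a b, [/\ e = [set a; b]%SET, adj a b, t a < t b,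
    ycoord x = (t a + t b) * xcoord x - t a * t b & t a <= xcoord x <= t b].
Proof.
move=> tI Ee [u [v [E /parabola_chord[yx xin]]]].
(* The pair spanning the segment may differ from the pair that shows [e] to be an edge; it is the
   same pair up to order. *)
have uv : adj u v.
  case/imsetP: Ee => -[c d]; rewrite inE /= => cd E'.
  have : #|e| = 2%N by rewrite E' cards2; case: eqP => // cd'; rewrite cd' adj_irr in cd.
  have [uE vE] : u \in e /\ v \in e by rewrite E !inE !eqxx orbT.
  rewrite E cards2; case: (eqVneq u v) => // nuv _.
  move: uE vE nuv; rewrite E' !inE => /orP[]/eqP-> /orP[]/eqP->; rewrite ?eqxx //.
  by rewrite adj_sym.
case: (ltgtP (t u) (t v)) => [tuv|tuv|/tI tuv]; last by rewrite tuv adj_irr in uv.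
  by exists u, v; split=> //; apply/andP; split; nra.
exists v, u; rewrite finset.setUC adj_sym; split=> //; first by rewrite yx; ring.
by apply/andP; split; nra.
Qed.

(** Distinct chords with a common end have different slopes, hence meet only at that end; otherwise
    all four ends differ. *)
Lemma edge_chords (R : realType) (G : sgraph) (t : G -> R) (e f : {set G}) (x : plane R) :
  injective t -> e \in edges G -> f \in edges G -> e != f ->
  edge_segment (fun v => parabola (t v)) e x ->
  edge_segment (fun v => parabola (t v)) f x ->
  (exists2 v, v \in e /\ v \in f & x = parabola (t v)) \/
  exists a b c d, [/\ e = [set a; b]%SET, f = [set c; d]%SET, adj a b, adj c d &
    [/\ t a < t b, t c < t d,
     ycoord x = (t a + t b) * xcoord x - t a * t b,
     ycoord x = (t c + t d) * xcoord x - t c * t d &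
     [/\ t a <= xcoord x <= t b, t c <= xcoord x <= t d &
     [&& a != c, a != d, b != c & b != d]]]].
Proof.
move=> tI Ee Ef ef /(edge_chord tI Ee)[a [b [E ab tab yab xab]]].
move=> /(edge_chord tI Ef)[c [d [F cd tcd ycd xcd]]].
have share (u v w : G) : v != w -> u \in e -> u \in f ->
    ycoord x = (t u + t v) * xcoord x - t u * t v ->
    ycoord x = (t u + t w) * xcoord x - t u * t w ->
    exists2 v, v \in e /\ v \in f & x = parabola (t v).
  move=> vw ue uf yv yw; exists u => //.
  have : (t v - t w) * (xcoord x - t u) = 0 by lra.
  move/eqP; rewrite mulf_eq0 !subr_eq0 (inj_eq tI) (negPf vw) /= => /eqP xu.
  by apply: plane_eq; rewrite ?xcoord_parabola ?ycoord_parabola // yv xu; ring.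
have swap (u v : G) : (t u + t v) * xcoord x - t u * t v =
    (t v + t u) * xcoord x - t v * t u by ring.
have [ac|ac] := eqVneq a c.
  left; apply: (share a b d); rewrite ?E ?F ?ac ?inE ?eqxx ?orbT -?ac //.
  - by apply: contraNneq ef => bd; rewrite E F ac bd.
  - by rewrite ac.
have [ad|ad] := eqVneq a d.
  left; apply: (share a b c); rewrite ?E ?F ?ad ?inE ?eqxx ?orbT -?ad //.
  - by apply: contraNneq ef => bc; rewrite E F ad bc finset.setUC.
  - by rewrite swap ad.
have [bc|bc] := eqVneq b c.
  left; apply: (share b a d); rewrite ?E ?F ?bc ?inE ?eqxx ?orbT -?bc //.
  - by rewrite swap.
  - by rewrite bc.
have [bd|bd] := eqVneq b d.
  left; apply: (share b a c); rewrite ?E ?F ?bd ?inE ?eqxx ?orbT -?bd //.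
  - by rewrite swap.
  - by rewrite swap bd.
right; exists a, b, c, d; do 3!split=> //.
by rewrite ac ad bc bd.
Qed.

Lemma parabola_avoids (R : realType) (G : sgraph) (t : G -> R) (e : {set G}) (v : G) :
  injective t -> e \in edges G ->
  edge_segment (fun v => parabola (t v)) e (parabola (t v)) -> v \in e.
Proof.
move=> tI Ee /(edge_chord tI Ee)[a [b [-> _ _]]].
rewrite xcoord_parabola ycoord_parabola => yv _.
have : (t v - t a) * (t v - t b) = 0 by lra.
by move/eqP; rewrite mulf_eq0 !subr_eq0 !(inj_eq tI) !inE.
Qed.

(** If two of the edges share an end, the common point is a vertex and so belongs to all three.
    Otherwise the six ends are distinct and concurrency would annihilate the determinant. *)
Lemma parabola_no_three (R : realType) (G : sgraph) (t : G -> R) (e f g : {set G})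
    (x : plane R) : injective t ->
  (forall a b c d m n : G, uniq [:: a; b; c; d; m; n] ->
    concurrency (t a) (t b) (t c) (t d) (t m) (t n) != 0) ->
  [/\ e \in edges G, f \in edges G & g \in edges G] ->
  [/\ e != f, e != g & f != g] ->
  [/\ edge_segment (fun v => parabola (t v)) e x,
      edge_segment (fun v => parabola (t v)) f x &
      edge_segment (fun v => parabola (t v)) g x] ->
  exists2 v, [/\ v \in e, v \in f & v \in g] & x = parabola (t v).
Proof.
move=> tI tD [Ee Ef Eg] [ef eg fg] [xe xf xg].
have fin v : x = parabola (t v) ->
    exists2 v, [/\ v \in e, v \in f & v \in g] & x = parabola (t v).
  move=> xv; exists v => //; rewrite xv in xe xf xg.
  by split; exact: (parabola_avoids tI).
have [[v _ /fin //]|[a [b [c [d [E F ab cd [tab tcd yab ycd [_ _ n1]]]]]]]] :=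
  edge_chords tI Ee Ef ef xe xf.
have [[v _ /fin //]|[a' [b' [m [n [E' M _ mn [tab' tmn _ ymn [_ _ n2]]]]]]]] :=
  edge_chords tI Ee Eg eg xe xg.
have [[v _ /fin //]|[c' [d' [m' [n' [F' M' _ _ [tcd' tmn' _ _ [_ _ n3]]]]]]]] :=
  edge_chords tI Ef Eg fg xf xg.
(* Each use of [edge_chords] names the ends anew; disjointness of the edges carries the inequalities
   over to one choice of names. *)
have dis (h k : {set G}) u v w z : h = [set u; v]%SET -> k = [set w; z]%SET ->
    [&& u != w, u != z, v != w & v != z] -> [disjoint h & k].
  move=> -> -> /and4P[uw uz vw vz]; apply/pred0P => y /=; rewrite !inE.
  apply/negP => /andP[/orP[]/eqP->];
    by rewrite ?(negPf uw) ?(negPf uz) ?(negPf vw) ?(negPf vz).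
have := dis _ _ _ _ _ _ E' M n2; have := dis _ _ _ _ _ _ F' M' n3.
have nE (u v w z : G) : [disjoint [set u; v]%SET & [set w; z]%SET] ->
    [/\ u != w, u != z, v != w & v != z].
  move=> /pred0P h; have := h u; have := h v.
  rewrite /= !inE !eqxx orbT /= => /negbT + /negbT.
  by rewrite !negb_or => /andP[-> ->] /andP[-> ->].
rewrite E F M => /nE[cm cn dm dn] /nE[am an bm bn].
case/and4P: n1 => ac ad bc bd.
have nt u v : t u < t v -> u != v by apply: contraTneq => ->; rewrite ltxx.
have /eqP[] : concurrency (t a) (t b) (t c) (t d) (t m) (t n) != 0.
  apply: tD; rewrite /= !inE !negb_or (nt _ _ tab) (nt _ _ tcd) (nt _ _ tmn).
  by rewrite ac ad bc bd am an bm bn cm cn dm dn.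
move: yab ycd ymn; rewrite /concurrency.
move: (t a + t b) (t a * t b) (t c + t d) (t c * t d) (t m + t n) (t m * t n).
move=> s1 p1 s2 p2 s3 p3 h1 h2 h3.
(* The determinant has rows [(1, s, p)], and these equations make its last column a combination of
   the other two. *)
have -> : p1 = s1 * xcoord x - ycoord x by lra.
have -> : p2 = s2 * xcoord x - ycoord x by lra.
have -> : p3 = s3 * xcoord x - ycoord x by lra.
by ring.
Qed.

(** * Crossings and their ends *)

(** The intersection of two chord lines of different slopes [a + b] and [c + d]; a crossing is thus
    determined by its four ends. *)
Definition chord_meet (R : realType) (a b c d : R) : plane R :=
  let x := (a * b - c * d) / (a + b - (c + d)) in
  (\row_(j < 2) (if j == 0 then x else (a + b) * x - a * b) : 'rV[R]_2).

Lemma parabola_crossing (R : realType) (G : sgraph) (t : G -> R) (x : plane R) :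
  injective t -> crossings (fun v => parabola (t v)) x ->
  exists a b c d, [/\ adj a b, adj c d, t a < t c < t b, t b < t d &
    x = chord_meet (t a) (t b) (t c) (t d)].
Proof.
move=> tI [e [f [[Ee Ef ef] [xe xf nv]]]].
have [[v [ve vf] xv]|[a [b [c [d [_ _ ab cd [tab tcd yab ycd [xab xcd /and4P[ac ad bc bd]]]]]]]]] :=
  edge_chords tI Ee Ef ef xe xf; first by case: nv; exists v.
have key (p q r s : G) : adj p q -> adj r s -> t p < t q -> t r < t s ->
  q != r -> q != s -> ycoord x = (t p + t q) * xcoord x - t p * t q ->
  ycoord x = (t r + t s) * xcoord x - t r * t s ->
  t p <= xcoord x <= t q -> t r <= xcoord x <= t s -> t p < t r ->
  exists a b c d, [/\ adj a b, adj c d, t a < t c < t b, t b < t d &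
    x = chord_meet (t a) (t b) (t c) (t d)].
  move=> pq rs tpq trs qr qs ypq yrs /andP[px xq] /andP[rx xs] tpr.
  have trq : t r < t q by rewrite lt_neqAle (inj_eq tI) eq_sym qr (le_trans rx).
  have tqs : t q < t s.
    rewrite ltNge le_eqVlt (inj_eq tI) eq_sym (negPf qs) /=; apply/negP => tsq.
    (* Both products equal the height of [x] above the parabola, yet for nested chords the outer one
       would be strictly larger. *)
    have : (xcoord x - t p) * (t q - xcoord x) = (xcoord x - t r) * (t s - xcoord x) by lra.
    nra.
  exists p, q, r, s; split=> //; first by rewrite tpr.
  have n0 : t p + t q - (t r + t s) != 0 by lra.
  have xE : xcoord x = (t p * t q - t r * t s) / (t p + t q - (t r + t s)).
    by apply: (mulIf n0); rewrite mulfVK //; lra.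
  by apply: plane_eq; rewrite /xcoord /ycoord /chord_meet !mxE /= -?xE.
case: (ltgtP (t a) (t c)) => [tac|tca|/tI eac]; first exact: (key a b c d).
  by apply: (key c d a b); rewrite // eq_sym.
by rewrite eac eqxx in ac.
Qed.

(** * Counting the crossings *)

(** Turns a labelling of the crossings into the exact finite cardinality that the crossing number
    refers to, bounded by the number of labels. *)
Lemma card_sub_finset_image (T : choiceType) (I : finType) (S : {set I}) (g : I -> T)
    (A : set T) : (forall x, A x -> exists2 i, i \in S & x = g i) ->
  exists2 k, (A #= `I_k)%card & (k <= #|S|)%N.
Proof.
move=> AS; have [S0|[i0 i0S]] := finset.set_0Vmem S.
  exists 0%N => //; rewrite II0.
  rewrite (_ : A = classical_sets.set0) ?card_eqxx //; apply/seteqP; split=> // x /AS[i].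
  by rewrite S0 inE.
pose h n := g (nth i0 (enum S) n).
have Ah : (A #<= `I_#|S|)%card.
  apply: card_le_trans (card_image_le h _); apply: subset_card_le => x /AS[i iS ->].
  exists (index i (enum S)); last by rewrite /h nth_index // mem_enum.
  by rewrite /= cardE index_mem mem_enum.
have /finite_setP[k Ak] : finite_set A by apply/finite_set_leP; exists #|S|.
by exists k; rewrite -?card_le_II -?(card_le_eql Ak).
Qed.

(** Ordering its ends by [r] gives each edge exactly one ordered pair. *)
Lemma sum_edges (G : sgraph) (r : G -> nat) (F : G -> nat) : injective r ->
  (\sum_(e in edges G) \prod_(v in e) F v =
   \sum_(p : G * G | adj p.1 p.2 && (r p.1 < r p.2)) F p.1 * F p.2)%N.
Proof.
move=> rI; pose A : {set G * G} := [set p | adj p.1 p.2 && (r p.1 < r p.2)%N]%SET.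
have E : edges G = [set [set p.1; p.2]%SET | p in A]%SET.
  apply/setP => e; apply/imsetP/imsetP => -[[a b]]; rewrite inE /= => ab ->.
    case: (ltngtP (r a) (r b)) => [rab|rba|/rI eab].
    - by exists (a, b) => //; rewrite inE ab.
    - by exists (b, a); rewrite ?inE /= 1?adj_sym ?ab // finset.setUC.
    - by rewrite eab adj_irr in ab.
  by case/andP: ab => ab _; exists (a, b); rewrite ?inE.
rewrite E big_imset /=; last first.
  move=> [a b] [c d]; rewrite !inE /= => /andP[_ ab] /andP[_ cd] eq.
  have : a \in [set c; d]%SET by rewrite -eq !inE eqxx.
  have : b \in [set c; d]%SET by rewrite -eq !inE eqxx orbT.
  rewrite !inE => /orP[]/eqP bE /orP[]/eqP aE; move: ab; rewrite aE bE ?ltnn //.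
  by move=> dc; have := ltn_trans cd dc; rewrite ltnn.
apply: eq_big => [p|[a b]]; rewrite !inE //= => /andP[ab _].
rewrite big_setU1 ?big_set1 // inE; apply: contraTneq ab => ->; by rewrite adj_irr.
Qed.

Theorem theorem20 (R : realType) (G : sgraph) (chordalG : chordal G) :
  (convex_crossing_number R G
     <= \sum_(e in edges G) \prod_(v in e) deg v)%N.
Proof.
have [r rI rP] := chordal_rank chordalG.
pose t v : R := (abscissa (r v))%:R.
have tI : injective t.
  by move=> u v /eqP; rewrite eqr_nat => /eqP/abscissa_inj/rI.
have tlt u v : (t u < t v) = (r u < r v)%N by rewrite ltr_nat abscissa_mono.
have tD (a b c d m n : G) : uniq [:: a; b; c; d; m; n] ->
    concurrency (t a) (t b) (t c) (t d) (t m) (t n) != 0.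
  (* The determinant is an integer polynomial, so its nonvanishing passes from the integers to
     [R]. *)
  rewrite -(map_inj_uniq rI) => /concurrency_abscissa.
  rewrite -(intr_eq0 R) /concurrency.
  by rewrite !(rmorphD, rmorphN, rmorphM).
pose d := ConvexDrawing (inj_comp (@parabola_inj R) tI) (parabola_convex tI)
  (fun e v => @parabola_avoids R G t e v tI)
  (fun e f g x => @parabola_no_three R G t e f g x tI tD).
(* A label [((a, c), (b, e))] records the edge [ac] that is charged, with a neighbour [b] of [a] and
   a neighbour [e] of [c]. *)
pose S : {set (G * G) * (G * G)} := [set q | [&& adj q.1.1 q.1.2,
  (r q.1.1 < r q.1.2)%N, adj q.1.1 q.2.1 & adj q.1.2 q.2.2]]%SET.
pose g (q : (G * G) * (G * G)) := chord_meet (t q.1.1) (t q.2.1) (t q.1.2) (t q.2.2).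
have [x|k dk kS] := @card_sub_finset_image _ _ S g (crossings d).
  move/(parabola_crossing tI) => [a [b [c [e [ab ce tacb tbe xE]]]]].
  exists ((a, c), (b, e)) => //; rewrite inE /= ab ce -tlt.
  move: (tacb) => /andP[-> _]; rewrite !tlt in tacb tbe.
  by rewrite (rP a b c e) // ltnW.
(* Over a fixed edge [ac] the labels form the product of the neighbourhoods of [a] and [c]. *)
have SE : #|S| = (\sum_(e in edges G) \prod_(v in e) deg v)%N.
  rewrite (sum_edges _ rI) -sum1_card.
  rewrite [LHS](eq_bigl (fun q : (G * G) * (G * G) => (adj q.1.1 q.1.2 && (r q.1.1 < r q.1.2)%N)
    && (q.2 \in finset.setX [set w | adj q.1.1 w]%SET [set w | adj q.1.2 w]%SET))).
    rewrite -(pair_big_dep (fun p : G * G => adj p.1 p.2 && (r p.1 < r p.2)%N)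
      (fun p q => q \in finset.setX [set w | adj p.1 w]%SET [set w | adj p.2 w]%SET)
      (fun _ _ => 1%N)) /=.
    by apply: eq_bigr => p _; rewrite sum1_card cardsX.
  by move=> [[a c] [b e]]; rewrite !inE /= -!andbA.
rewrite -SE; apply: leq_trans kS.
rewrite /convex_crossing_number; case: ex_minnP => m _; apply.
by apply/asboolP; exists d.
Qed.
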